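(* Let $J:\mathbb{R}^n\to\mathbb{R}$ satisfy: (1) $J$ is continuously differentiable on $\mathbb{R}^n$; (2) there is a unique minimizer $\theta_*\in\mathbb{R}^n$, i.e. $J(\theta_* )<J(\theta)$ for all $\theta\neq\theta_*$; (3) $\nabla J(\theta)=0$ if and only if $\theta=\theta_*$; (4) $J$ is radially unbounded, i.e. $J(\theta)\to\infty$ as $\|\theta\|\to\infty$. For each $i=1,\dots,n$, the equilibrium value $v_{i,*}$ of the average squared-gradient-magnitude estimate satisfies $v_{i,*}\to 0$ as $a_0\to 0$, where $$v_{i,*}=\frac1T\int_0^T m_i(\tau)^2\left(J(\theta_*+s(\tau))-\xi_*\right)^2d\tau,\qquad \xi_*=\frac1T\int_0^T J(\theta_*+s(\tau))\,d\tau .$$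
   Context: Here $s(t)=(s_1(t),\dots,s_n(t))$ with $s_i(t)=a_i\sin(\omega r_i t)$, $m_i(t)=\frac{2}{a_i}\sin(\omega r_i t)$, $\omega>0$, $T=2\pi/\omega$, the $r_i$ are fixed nonzero integers, $a_i\neq0$, and $a_0=\sqrt{\sum_{i=1}^n a_i^2}$. The limit $a_0\to0$ is taken with the ratios $a_i/a_0$ (all nonzero) held fixed. The quantities $\xi_*$ and $v_{i,*}$ are the equilibrium components, at $\theta=\theta_*$, of the averaged filter equations $\dot{\bar\xi}=\omega_\xi(\bar J(\theta)-\bar\xi)$ and $\dot{\bar{\hat v}}_i=\omega_{l,i}\left(\overline{\hat g_i^2}(\theta,\bar\xi)-\bar{\hat v}_i\right)$, where $\bar J(\theta)=\frac1T\int_0^T J(\theta+s(\tau))d\tau$ and $\overline{\hat g_i^2}(\theta,\xi)=\frac1T\int_0^T m_i(\tau)^2(J(\theta+s(\tau))-\xi)^2d\tau$, with constants $\omega_\xi,\omega_{l,i}>0$. *)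

(* Defs.v *)
From HB Require Import structures.
From mathcomp Require Import all_boot all_order all_algebra.
From mathcomp Require Import all_classical all_reals all_analysis.

Set Implicit Arguments.
Unset Strict Implicit.
Unset Printing Implicit Defensive.

Import Order.TTheory GRing.Theory Num.Theory.
Import numFieldNormedType.Exports.

Local Open Scope classical_set_scope.
Local Open Scope ring_scope.

(* The library norm on 'rV[R]_n is the sup norm; this is the Euclidean one. *)
Definition enorm (R : realType) (n : nat) (x : 'rV[R]_n) : R :=
  Num.sqrt (\sum_(i < n) x 0 i ^+ 2).

Definition gradient (R : realType) (n : nat) (J : 'rV[R]_n -> R)
    (x : 'rV[R]_n) : 'rV[R]_n :=
  \row_(i < n) 'D_(delta_mx 0 i) J x.

Definition continuously_differentiable (R : realType) (n : nat)
    (J : 'rV[R]_n -> R) : Prop :=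
  (forall x : 'rV[R]_n, differentiable J x) /\ continuous (gradient J).

Definition unique_minimizer (R : realType) (n : nat) (J : 'rV[R]_n -> R)
    (theta_star : 'rV[R]_n) : Prop :=
  forall theta : 'rV[R]_n, theta <> theta_star -> J theta_star < J theta.

Definition radially_unbounded (R : realType) (n : nat)
    (J : 'rV[R]_n -> R) : Prop :=
  forall M : R, exists K : R,
    forall theta : 'rV[R]_n, K < enorm theta -> M < J theta.

Definition period (R : realType) (omega : R) : R := 2 * pi / omega.

Definition time_average (R : realType) (T : R) (f : R -> R) : R :=
  T^-1 * \int[lebesgue_measure]_(tau in `[0, T]) f tau.

(* s(t), with amplitudes a, base frequency omega and frequency multiples r *)
Definition dither (R : realType) (n : nat) (omega : R) (r : 'I_n -> int)
    (a : 'rV[R]_n) (t : R) : 'rV[R]_n :=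
  \row_(i < n) (a 0 i * sin (omega * (r i)%:~R * t)).

(* m_i(t) *)
Definition demodulation (R : realType) (n : nat) (omega : R) (r : 'I_n -> int)
    (a : 'rV[R]_n) (i : 'I_n) (t : R) : R :=
  2 / a 0 i * sin (omega * (r i)%:~R * t).

Definition average_cost (R : realType) (n : nat) (J : 'rV[R]_n -> R)
    (omega : R) (r : 'I_n -> int) (a theta : 'rV[R]_n) : R :=
  time_average (period omega) (fun tau => J (theta + dither omega r a tau)).

Definition average_sq_gradient (R : realType) (n : nat) (J : 'rV[R]_n -> R)
    (omega : R) (r : 'I_n -> int) (a : 'rV[R]_n) (i : 'I_n)
    (theta : 'rV[R]_n) (xi : R) : R :=
  time_average (period omega) (fun tau =>
    demodulation omega r a i tau ^+ 2 *
    (J (theta + dither omega r a tau) - xi) ^+ 2).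

(* (xi, v) is a zero of the right-hand sides of the averaged filter equations
     xi'  = omega_xi  * (Jbar(theta) - xi)
     v_i' = omega_l_i * (g_i^2bar(theta, xi) - v_i)
   at the given theta. *)
Definition filter_equilibrium (R : realType) (n : nat) (J : 'rV[R]_n -> R)
    (omega : R) (r : 'I_n -> int) (omega_xi : R) (omega_l : 'I_n -> R)
    (a theta : 'rV[R]_n) (xi : R) (v : 'rV[R]_n) : Prop :=
  omega_xi * (average_cost J omega r a theta - xi) = 0 /\
  forall i : 'I_n,
    omega_l i * (average_sq_gradient J omega r a i theta xi - v 0 i) = 0.

(* Main.v *)
(** Since theta_star is a critical point, J (theta_star + h) differs from
    J theta_star by o(h).  The dither has sup norm at most a_0 * |rho|, so along
    it J oscillates by o(a_0), and hence so does the centred signal J - xi_star.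
    The demodulation factor is only O(1 / a_0), so the averaged square
    v_{i,*} is O(1 / a_0^2) * o(a_0)^2 = o(1). *)
Require Import Defs.
From HB Require Import structures.
From mathcomp Require Import all_boot all_order all_algebra.
From mathcomp Require Import all_classical all_reals all_analysis.
From mathcomp Require Import ring.
Import Order.TTheory GRing.Theory Num.Theory.
Import numFieldNormedType.Exports.
Local Open Scope classical_set_scope.
Local Open Scope ring_scope.

(** Monotonicity of the integral between the constants [c - e] and [c + e]. It serves twice: for the
    averaged cost, and for the averaged square with centre 0. *)
Lemma time_average_dist_le (R : realType) (T : R) (f : R -> R) (c e : R) :
  0 < T -> continuous f -> (forall t, `|f t - c| <= e) ->
  `|time_average T f - c| <= e.
Proof.
move=> T0 cf fce.
have integ (g : R -> R) : continuous g ->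
    lebesgue_measure.-integrable `[0, T] (EFin \o g).
  move=> cg; apply: continuous_compact_integrable; first exact: segment_compact.
  exact: continuous_subspaceT.
have cstE k : \int[lebesgue_measure]_(x in `[0, T]) k = T * k.
  rewrite Rintegral_cst//= lebesgue_measure_itv/= lte_fin T0 -EFinD /=.
  by rewrite subr0 mulrC.
have intcst (k : R) : lebesgue_measure.-integrable `[0, T] (EFin \o cst k).
  by apply: integ => x; exact: cvg_cst.
have lo : T * (c - e) <= \int[lebesgue_measure]_(x in `[0, T]) f x.
  rewrite -cstE; apply: le_Rintegral => //; [exact: intcst|exact: integ|].
  by move=> x _; have := fce x; rewrite ler_distl => /andP[].
have hi : \int[lebesgue_measure]_(x in `[0, T]) f x <= T * (c + e).
  rewrite -cstE; apply: le_Rintegral => //; [exact: integ|exact: intcst|].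
  by move=> x _; have := fce x; rewrite ler_distl => /andP[].
rewrite ler_distl /time_average mulrC ler_pdivlMr// ler_pdivrMr//.
by rewrite ![_ * T]mulrC lo hi.
Qed.

Lemma continuous_sin_scale (R : realType) (k : R) :
  continuous (fun t => sin (k * t)).
Proof.
move=> t; apply: (@continuous_comp _ _ _ (fun t => k * t) sin).
  exact: mulrl_continuous.
exact: continuous_sin.
Qed.

Lemma continuous_dither (R : realType) (n : nat) (omega : R) (r : 'I_n -> int)
    (a : 'rV[R]_n) : continuous (dither omega r a).
Proof.
(* Expanding along the basis rows reduces continuity to that of the scalar coefficients. *)
have -> : dither omega r a = fun t => \sum_(i < n)
    (a 0 i * sin (omega * (r i)%:~R * t)) *: delta_mx 0 i.
  apply/funext => t; rewrite [LHS]row_sum_delta.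
  by apply: eq_bigr => i _; rewrite mxE.
move=> t; apply: cvg_big => [|i _]; [exact: add_continuous|apply: cvgZr_tmp].
apply: cvgMl_tmp; exact: continuous_sin_scale.
Qed.

Lemma norm_dither_le (R : realType) (n : nat) (omega : R) (r : 'I_n -> int)
    (a : 'rV[R]_n) (t : R) : `|dither omega r a t| <= `|a|.
Proof.
rewrite [leLHS]mx_normrE; apply: bigmax_le => // -[i j] _ /=.
rewrite mxE normrM; apply: (@le_trans _ _ `|a 0 j|).
  by rewrite ler_piMr// sin_max.
rewrite [leRHS]mx_normrE.
exact: (le_bigmax _ (fun ij : 'I_1 * 'I_n => `|a ij.1 ij.2|) (0, j)).
Qed.

(** The differential is linear and its values on the basis rows are the partial derivatives, so it
    vanishes; only the remainder of the first-order expansion is left. *)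
Lemma gradient0_littleo (R : realType) (n : nat) (J : 'rV[R]_n -> R)
    (x : 'rV[R]_n) (e : R) : differentiable J x -> gradient J x = 0 -> 0 < e ->
  \forall h \near (0 : 'rV[R]_n), `|J (x + h) - J x| <= e * `|h|.
Proof.
move=> dJ gJ e0.
have dJ0 h : 'd J x h = 0.
  rewrite (row_sum_delta h) linear_sum big1// => i _.
  rewrite linearZ -deriveE//.
  by have /rowP/(_ i) := gJ; rewrite !mxE => ->; exact: mulr0.
have /eqaddoP/(_ e e0) := diff_locally dJ.
apply: filterS => h; rewrite !fctE /= dJ0 addr0.
by rewrite (addrC h).
Qed.

(** The average of [J] is itself within [e] of [c], so the centred signal is at most [2 * e]; the
    demodulation is at most [2 / a 0 i] in absolute value, whence the factor 4. If [a 0 i = 0], the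
    convention [0^-1 = 0] makes both sides vanish. *)
Lemma average_sq_gradient_le (R : realType) (n : nat) (J : 'rV[R]_n -> R)
    (omega : R) (r : 'I_n -> int) (a theta : 'rV[R]_n) (i : 'I_n) (c e : R) :
  0 < omega -> continuous J ->
  (forall t, `|J (theta + dither omega r a t) - c| <= e) ->
  `|average_sq_gradient J omega r a i theta (average_cost J omega r a theta)|
    <= (4 * e / a 0 i) ^+ 2.
Proof.
move=> omega0 cJ Jce.
have T0 : 0 < period omega by rewrite divr_gt0// mulr_gt0// pi_gt0.
have cJd : continuous (fun t => J (theta + dither omega r a t)).
  move=> t.
  apply: (@continuous_comp _ _ _ (fun u => theta + dither omega r a u) J).
    apply: cvgD; [exact: cvg_cst|exact: continuous_dither].
  exact: cJ.
have := @time_average_dist_le _ _ _ c e T0 cJd Jce.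
rewrite -/(average_cost J omega r a theta).
set xi := average_cost _ _ _ _ _ => xic.
(* Read as a distance to 0, the average only needs a pointwise bound on its integrand. *)
rewrite -[X in `|X|]subr0; apply: time_average_dist_le => //.
  have csq (g : R -> R) (t l : R) : g u @[u --> t] --> l ->
      g u ^+ 2 @[u --> t] --> l ^+ 2.
    move=> cg; apply: (cvg_comp _ (fun x : R => x ^+ 2) cg).
    exact: exprn_continuous.
  move=> t; apply: cvgM; apply: csq.
    by apply: cvgMl_tmp; exact: continuous_sin_scale.
  by apply: cvgB; [exact: cJd|exact: cvg_cst].
(* The sign of [a 0 i] is unknown, so both squares become squares of absolute values before the
   roots are compared. *)
move=> t; rewrite subr0 -exprMn normrX -[leRHS]real_normK ?num_real//.
rewrite ler_sqr ?nnegrE//.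
have -> : 4 * e / a 0 i = (2 / a 0 i) * (2 * e) by ring.
have e0 : 0 <= e by apply: le_trans (Jce 0).
rewrite !normrM -!mulrA ler_wpM2l// ler_wpM2l//.
apply: (@le_trans _ _ (1 * (2 * e))); last by rewrite mul1r -normrM ler_norm.
rewrite ler_pM// ?sin_max//.
have -> : J (theta + dither omega r a t) - xi =
  (J (theta + dither omega r a t) - c) - (xi - c) by ring.
by apply: le_trans (ler_normB _ _) _; rewrite mulr2n mulrDl mul1r lerD.
Qed.

Theorem corollary1 (R : realType) (n : nat) (J : 'rV[R]_n -> R)
    (theta_star : 'rV[R]_n)
    (J_C1 : continuously_differentiable J)
    (J_min : unique_minimizer J theta_star)
    (J_crit : forall theta : 'rV[R]_n,
        gradient J theta = 0 <-> theta = theta_star)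
    (J_unbounded : radially_unbounded J)
    (omega : R) (omega_gt0 : 0 < omega)
    (r : 'I_n -> int) (r_neq0 : forall i : 'I_n, r i <> 0)
    (omega_xi : R) (omega_xi_gt0 : 0 < omega_xi)
    (omega_l : 'I_n -> R) (omega_l_gt0 : forall i : 'I_n, 0 < omega_l i)
    (* rho_i = a_i / a_0 are the fixed ratios, so a = a_0 *: rho *)
    (rho : 'rV[R]_n) (rho_neq0 : forall i : 'I_n, rho 0 i <> 0)
    (rho_unit : enorm rho = 1)
    (xi_star : R -> R) (v_star : R -> 'rV[R]_n)
    (equilibrium : forall a0 : R, 0 < a0 ->
        filter_equilibrium J omega r omega_xi omega_l
          (a0 *: rho) theta_star (xi_star a0) (v_star a0)) :
  forall i : 'I_n,
    (forall a0 : R, 0 < a0 ->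
       xi_star a0 = time_average (period omega) (fun tau =>
         J (theta_star + dither omega r (a0 *: rho) tau)) /\
       v_star a0 0 i = time_average (period omega) (fun tau =>
         demodulation omega r (a0 *: rho) i tau ^+ 2 *
         (J (theta_star + dither omega r (a0 *: rho) tau)
            - xi_star a0) ^+ 2)) /\
    v_star a0 0 i @[a0 --> 0^'+] --> 0.
Proof.
have [dJ _] := J_C1.
have cJ : continuous J by move=> x; exact: differentiable_continuous.
(* The filter gains are positive, hence cancel from the equilibrium equations. *)
have eqs a0 : 0 < a0 ->
    xi_star a0 = average_cost J omega r (a0 *: rho) theta_star /\
    forall i, v_star a0 0 i =
      average_sq_gradient J omega r (a0 *: rho) i theta_star (xi_star a0).
  move=> /equilibrium[/eqP + v_eq]; rewrite mulf_eq0 gt_eqF//= subr_eq0.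
  move=> /eqP xiE; split => [//|i]; have /eqP := v_eq i.
  by rewrite mulf_eq0 gt_eqF//= subr_eq0 => /eqP <-.
move=> i; split=> [a0 /eqs[xiE vE]|]; first by split; [exact: xiE|exact: vE].
have rhoi0 : 0 < `|rho 0 i| by rewrite normr_gt0; apply/eqP.
(* With oscillation [d * (a0 * |rho|)] and amplitude [a0 * rho 0 i], the factor [a0] cancels in the
   bound above and leaves [(d * K) ^+ 2]. *)
pose K := 4 * `|rho| / `|rho 0 i|.
have K0 : 0 <= K by rewrite divr_ge0// mulr_ge0.
apply/cvgrPdist_le => e e0.
(* Chosen so that [d * K <= Num.sqrt e]; the [+ 1] keeps the denominator positive. *)
pose d := Num.sqrt e / (K + 1).
have d0 : 0 < d by rewrite divr_gt0 ?sqrtr_gt0// ltr_wpDl.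
have gJ : gradient J theta_star = 0 by apply/J_crit.
have /nbhs_ballP[del /= del0 Hdel] := @gradient0_littleo _ _ _ _ _ (dJ _) gJ d0.
have M0 : 0 < `|rho| + 1 by rewrite ltr_wpDl.
near=> a0.
have a00 : 0 < a0 by near: a0; exact: nbhs_right_gt.
(* This keeps the whole dither orbit inside the ball of radius [del] where the little-o estimate
   holds. *)
have a0del : a0 < del / (`|rho| + 1).
  by near: a0; apply: nbhs_right_lt; rewrite divr_gt0.
have [xiE ->] := eqs _ a00.
rewrite sub0r normrN xiE.
have osc t : `|J (theta_star + dither omega r (a0 *: rho) t) - J theta_star|
    <= d * (a0 * `|rho|).
  have nd := @norm_dither_le _ _ omega r (a0 *: rho) t.
  rewrite normrZ (gtr0_norm a00) in nd.
  apply: le_trans (Hdel _ _) _; last by rewrite ler_pM2l.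
  rewrite -ball_normE /ball_ /= sub0r normrN; apply: le_lt_trans nd _.
  rewrite ltr_pdivlMr// in a0del; apply: le_lt_trans a0del.
  by rewrite ler_pM2l// lerDl.
have := @average_sq_gradient_le _ _ _ _ _ _ _ i _ _ omega_gt0 cJ osc.
move=> /le_trans; apply.
rewrite -(sqr_sqrtr (ltW e0)) -[leLHS]real_normK ?num_real//.
rewrite ler_sqr ?nnegrE ?sqrtr_ge0//.
have -> : `|4 * (d * (a0 * `|rho|)) / (a0 *: rho) 0 i| = d * K.
  rewrite mxE normrM normfV ger0_norm ?pmulr_rge0//.
  rewrite normrM (gtr0_norm a00) /K; field.
  by rewrite !gt_eqF.
by rewrite /d mulrAC ler_pdivrMr ?ltr_wpDl// ler_wpM2l ?sqrtr_ge0// lerDl.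
Unshelve. all: by end_near. Qed.
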